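(* Let $L$ and $L'$ be $L_\infty$-algebras over $\mathbb{F}_2$ and let $I=\{I_n\}: L'\to L$ be a homomorphism of $L_\infty$-algebras. Then there is an induced functor $I^*: L\text{-mod}\to L'\text{-mod}$, called restriction of scalars, given as follows. On an $L_\infty$-module $(M,k)$ over $L$, $I^*M=(M,k')$, where $k'_1=k_1$ and, for $n\ge 2$, $$k_n'=\sum_{r=1}^{n-1}\ \sum_{\substack{i_1+\cdots+i_r=n-1\\ \tau\in S'(i_1,\ldots,i_r)}} k_{r+1}\circ(I_{i_1}\otimes\cdots\otimes I_{i_r}\otimes \mathrm{Id})\circ(\tau^\bullet\otimes\mathrm{Id}):\ (L')^{\otimes(n-1)}\otimes M\to M .$$ On an $L_\infty$-module homomorphism $f=\{f_n\}:M\to N$ over $L$, $(I^*f)_1=f_1$ and, for $n\ge 2$, $$(I^*f)_n=\sum_{r=1}^{n-1}\ \sum_{\substack{i_1+\cdots+i_r=n-1\\ \tau\in S'(i_1,\ldots,i_r)}} f_{r+1}\circ(I_{i_1}\otimes\cdots\otimes I_{i_r}\otimes \mathrm{Id})\circ(\tau^\bullet\otimes\mathrm{Id}):\ (L')^{\otimes(n-1)}\otimes M\to N .$$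
   Context: All vector spaces are graded and over $\mathbb{F}_2$; no signs appear anywhere. Unshuffles. For $\sigma\in S_n$, $\sigma^\bullet$ sends $x_1\otimes\cdots\otimes x_n$ to $x_{\sigma(1)}\otimes\cdots\otimes x_{\sigma(n)}$. For $i_1+\cdots+i_r=n$, $S(i_1,\ldots,i_r)\subset S_n$ is the set of $(i_1,\ldots,i_r)$-unshuffles: permutations $\sigma$ that are increasing on each of the consecutive blocks of positions of sizes $i_1,\ldots,i_r$, i.e. $\sigma(i_1+\cdots+i_{l-1}+1)<\cdots<\sigma(i_1+\cdots+i_l)$ for each $l$. $S'(i_1,\ldots,i_r)$ is the set of $\sigma\in S(i_1,\ldots,i_r)$ where, in addition, $i_1\le\cdots\le i_r$ and $\sigma(i_1+\cdots+i_{l-1}+1)<\sigma(i_1+\cdots+i_l+1)$ whenever $i_l=i_{l+1}$ (so $S'$ is empty unless $i_1\le\cdots\le i_r$). In sums over $S'(i_1,\ldots,i_r)$ all $i_l\ge 1$, and the sum runs over all such tuples $(i_1,\ldots,i_r)$ with the given total and all elements of $S'(i_1,\ldots,i_r)$. $L_\infty$-algebra. A graded vector space $L$ with symmetric multilinear maps $l_k:L^{\otimes k}\to L$ ($k\ge1$) of degree $k-2$ ($l_k\circ\sigma^\bullet=l_k$ for $\sigma\in S_k$) such that for all $n\ge1$ $$\sum_{i+j=n+1}\sum_{\sigma\in S(i,n-i)} l_j\circ(l_i\otimes\mathrm{Id})\circ\sigma^\bullet=0\qquad(i,j\ge1).$$ $L_\infty$-algebra homomorphism $f:(L,l)\to(L',l')$.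 Symmetric multilinear maps $f_n:L^{\otimes n}\to L'$ ($n\ge1$) of degree $n-1$ such that for all $n\ge 1$ $$\sum_{j+k=n+1}\sum_{\sigma\in S(k,n-k)} f_j\circ(l_k\otimes\mathrm{Id})\circ\sigma^\bullet=\sum_{r}\sum_{\substack{i_1+\cdots+i_r=n\\ \tau\in S'(i_1,\ldots,i_r)}} l'_r\circ(f_{i_1}\otimes\cdots\otimes f_{i_r})\circ\tau^\bullet .$$ $L_\infty$-module over $(L,l)$. A graded vector space $M$ with multilinear maps $k_n:L^{\otimes(n-1)}\otimes M\to M$ ($n\ge1$) of degree $n-2$, symmetric in the $L$-inputs, such that for all $n\ge1$, $x_1,\ldots,x_{n-1}\in L$, $x_n\in M$, $$\sum_{\substack{p+q=n+1\\ p<n}}\ \sum_{\substack{\sigma\in S(p,n-p)\\ \sigma(n)=n}} k_q\big(l_p(x_{\sigma(1)},\ldots,x_{\sigma(p)}),x_{\sigma(p+1)},\ldots,x_{\sigma(n)}\big)+\sum_{p+q=n+1}\ \sum_{\substack{\sigma\in S(p,n-p)\\ \sigma(p)=n}} k_q\big(x_{\sigma(p+1)},\ldots,x_{\sigma(n)},k_p(x_{\sigma(1)},\ldots,x_{\sigma(p)})\big)=0 .$$ $L_\infty$-module homomorphism $h:(M,k)\to(M',k')$ over $L$. Multilinear maps $h_n:L^{\otimes(n-1)}\otimes M\to M'$ ($n\ge1$) of degree $n-1$, symmetric in the $L$-inputs, such that for all $n\ge1$, $x_1,\ldots,x_{n-1}\in L$, $x_n\in M$, $$\sum_{\substack{i+j=n+1\\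 i<n}}\ \sum_{\substack{\sigma\in S(i,n-i)\\ \sigma(n)=n}} h_j\big(l_i(x_{\sigma(1)},\ldots,x_{\sigma(i)}),x_{\sigma(i+1)},\ldots,x_{\sigma(n)}\big)+\sum_{i+j=n+1}\ \sum_{\substack{\sigma\in S(i,n-i)\\ \sigma(i)=n}} h_j\big(x_{\sigma(i+1)},\ldots,x_{\sigma(n)},k_i(x_{\sigma(1)},\ldots,x_{\sigma(i)})\big)$$ $$=\sum_{r+s=n+1}\ \sum_{\tau\in S(n-s,s-1)} k'_r\big(x_{\tau(1)},\ldots,x_{\tau(n-s)},h_s(x_{\tau(n-s+1)},\ldots,x_{\tau(n-1)},x_n)\big).$$ The category $L\text{-mod}$ has $L_\infty$-modules over $L$ as objects and $L_\infty$-module homomorphisms as morphisms. The identity $\mathrm{Id}_M$ has $(\mathrm{Id}_M)_1$ the identity map of $M$ and $(\mathrm{Id}_M)_r=0$ for $r\ge2$. The composite of $A\xrightarrow{f}B\xrightarrow{g}C$ is $$(g\circ f)_n(x_1,\ldots,x_n)=\sum_{i+j=n+1}\ \sum_{\substack{\sigma\in S(i,n-i)\\ \sigma(i)=n}} g_j\big(x_{\sigma(i+1)},\ldots,x_{\sigma(n)},f_i(x_{\sigma(1)},\ldots,x_{\sigma(i)})\big),\quad x_1,\ldots,x_{n-1}\in L,\ x_n\in A.$$ In all indexed sums of the form $p+q=n+1$ the indices are $\ge1$. *)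

(* Defs.v *)
From mathcomp Require Import all_boot all_order all_algebra all_fingroup.
From mathcomp Require Import boolp ring.

Set Implicit Arguments.
Unset Strict Implicit.
Unset Printing Implicit Defensive.

Import GRing.Theory.
Local Open Scope ring_scope.

(* The total space is the internal direct sum of its homogeneous components
   [homog d], d an integer. *)
Record is_grading (V : lmodType 'F_2) (homog : int -> V -> Prop) : Prop :=
  IsGrading {
    grading0 : forall d, homog d 0;
    gradingP : forall d (a : 'F_2) u v,
      homog d u -> homog d v -> homog d (a *: u + v);
    grading_span : forall v, exists (s : seq int) (u : int -> V),
      (forall d, homog d (u d)) /\ v = \sum_(d <- s) u d;
    grading_free : forall (s : seq int) (u : int -> V),
      uniq s -> (forall d, homog d (u d)) -> \sum_(d <- s) u d = 0 ->
      forall d, d \in s -> u d = 0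
  }.

Record gvect := GVect {
  gv_space :> lmodType 'F_2;
  homog : int -> gv_space -> Prop;
  gv_grading : is_grading homog
}.

(* A family (f_n : U^{(x)n} -> V)_n is encoded as one function
   [f : seq U -> V], with f_n(x_1,...,x_n) = f [:: x_1; ...; x_n].  Families
   indexed by n >= 1 have an irrelevant value at [::]: every condition below
   is about nonempty sequences only. *)

Definition multilinear (U V : lmodType 'F_2) (f : seq U -> V) : Prop :=
  forall (s1 s2 : seq U) (a : 'F_2) (u v : U),
    f (s1 ++ (a *: u + v) :: s2) = a *: f (s1 ++ u :: s2) + f (s1 ++ v :: s2).

Definition homogeneous (V : gvect) (ds : seq int) (x : seq V) : Prop :=
  size ds = size x /\ forall i, (i < size x)%N -> homog ds`_i x`_i.

Definition has_degree (U V : gvect) (deg : nat -> int) (f : seq U -> V) :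
    Prop :=
  forall ds x, (0 < size x)%N -> homogeneous ds x ->
    homog (\sum_(d <- ds) d + deg (size x)) (f x).

(* A family (g_n : L^{(x)(n-1)} (x) M -> N)_{n >= 1} is encoded as
   [g : seq L -> M -> N], with
   g_n(x_1,...,x_n) = g [:: x_1; ...; x_{n-1}] x_n, so that n is the
   successor of the length of the sequence. *)

Definition multilinear_mod (L M N : lmodType 'F_2) (g : seq L -> M -> N) :
    Prop :=
  (forall m, multilinear (g^~ m)) /\
  (forall x (a : 'F_2) u v, g x (a *: u + v) = a *: g x u + g x v).

Definition has_degree_mod (L M N : gvect) (deg : nat -> int)
    (g : seq L -> M -> N) : Prop :=
  forall ds e x m, homogeneous ds x -> homog e m ->
    homog (\sum_(d <- ds) d + e + deg (size x).+1) (g x m).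

(* The sequence sigma(1), ..., sigma(n), with values counted from 0. *)
Definition oneline n (s : 'S_n) : seq nat := [seq val (s i) | i <- enum 'I_n].

(* The sequence x_{sigma(1)}, ..., x_{sigma(n)}.  It is also used for
   sigma in S_n with only the n - 1 first inputs in x, the last input x_n
   living in another space: the entry standing for x_n is then a dummy 0,
   which has to be removed. *)
Definition permute (V : nmodType) n (s : 'S_n) (x : seq V) : seq V :=
  [seq x`_i | i <- oneline s].

Definition symmetric_maps (U : nmodType) (T : Type) (f : seq U -> T) : Prop :=
  forall (x : seq U) (s : 'S_(size x)), f (permute s x) = f x.

(* S(i_1,...,i_r), for sh = [:: i_1; ...; i_r]: [reshape sh] cuts a sequence
   into consecutive blocks of sizes i_1, ..., i_r. *)
Definition unshuffle n (sh : seq nat) (s : 'S_n) : bool :=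
  (sumn sh == n) && all (sorted ltn) (reshape sh (oneline s)).

(* S'(i_1,...,i_r), including the convention i_l >= 1. *)
Definition unshuffle' n (sh : seq nat) (s : 'S_n) : bool :=
  [&& all (leq 1) sh, sorted leq sh, unshuffle sh s &
      sorted (fun b c => (size b == size c) ==> (head 0 b < head 0 c)%N)
             (reshape sh (oneline s))].

(* The sum over r and over all (i_1,...,i_r) of total n (so 1 <= r <= n when
   n >= 1) and all tau in S'(i_1,...,i_r) of
   F (x_{tau(1)},...,x_{tau(i_1)}) ... (x_{tau(n-i_r+1)},...,x_{tau(n)}). *)
Definition sum_S' (U V : nmodType) (x : seq U) (F : seq (seq U) -> V) : V :=
  let n := size x in
  \sum_(1 <= r < n.+1) \sum_(i : r.-tuple 'I_n.+1)
    \sum_(t : 'S_n | unshuffle' [seq val j | j <- i] t)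
      F (reshape [seq val j | j <- i] (permute t x)).

Record is_linfty_alg (L : gvect) (l : seq L -> L) : Prop := IsLInftyAlg {
  la_multilinear : multilinear l;
  la_symmetric : symmetric_maps l;
  la_degree : has_degree (fun k => k%:Z - 2) l;
  la_rel : forall x : seq L, (0 < size x)%N ->
    let n := size x in
    \sum_(1 <= i < n.+1)
      \sum_(s : 'S_n | unshuffle [:: i; (n - i)%N] s)
        l (l (take i (permute s x)) :: drop i (permute s x)) = 0
}.

Record linfty_alg := LInftyAlg {
  la_space :> gvect;
  la_op : seq la_space -> la_space;
  la_ax : is_linfty_alg la_op
}.

Record is_linfty_hom (L L' : linfty_alg) (f : seq L -> L') : Prop :=
  IsLInftyHom {
    lh_multilinear : multilinear f;
    lh_symmetric : symmetric_maps f;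
    lh_degree : has_degree (fun n => n%:Z - 1) f;
    lh_rel : forall x : seq L, (0 < size x)%N ->
      let n := size x in
      \sum_(1 <= k < n.+1)
        \sum_(s : 'S_n | unshuffle [:: k; (n - k)%N] s)
          f (la_op (take k (permute s x)) :: drop k (permute s x))
      = sum_S' x (fun bs => la_op (map f bs))
  }.

Record linfty_hom (L L' : linfty_alg) := LInftyHom {
  lh_fun :> seq L -> L';
  lh_ax : is_linfty_hom lh_fun
}.

(* Positions being counted from 0, sigma(p) = n is
   [s (inord p.-1) == ord_max]. *)

(* The left-hand side of the module relation is the case g = k; that of the
   homomorphism relation is the case g = h. *)
Definition mod_lhs (L : linfty_alg) (M N : gvect) (k : seq L -> M -> M)
    (g : seq L -> M -> N) (x : seq L) (m : M) : N :=
  let n := (size x).+1 in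
  \sum_(1 <= p < n)
    \sum_(s : 'S_n | unshuffle [:: p; (n - p)%N] s && (s ord_max == ord_max))
      g (la_op (take p (permute s x)) :: drop p (take n.-1 (permute s x))) m
  + \sum_(1 <= p < n.+1)
    \sum_(s : 'S_n | unshuffle [:: p; (n - p)%N] s
                     && (s (inord p.-1) == ord_max))
      g (drop p (permute s x)) (k (take p.-1 (permute s x)) m).

Record is_linfty_mod (L : linfty_alg) (M : gvect) (k : seq L -> M -> M) :
    Prop := IsLInftyMod {
  lm_multilinear : multilinear_mod k;
  lm_symmetric : forall m, symmetric_maps (k^~ m);
  lm_degree : has_degree_mod (fun n => n%:Z - 2) k;
  lm_rel : forall x m, mod_lhs k k x m = 0
}.

Record linfty_mod (L : linfty_alg) := LInftyMod {
  lm_space :> gvect;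
  lm_op : seq L -> lm_space -> lm_space;
  lm_ax : is_linfty_mod lm_op
}.

Record is_linfty_mod_hom (L : linfty_alg) (M M' : linfty_mod L)
    (h : seq L -> M -> M') : Prop := IsLInftyModHom {
  mh_multilinear : multilinear_mod h;
  mh_symmetric : forall m, symmetric_maps (h^~ m);
  mh_degree : has_degree_mod (fun n => n%:Z - 1) h;
  mh_rel : forall x m,
    let n := (size x).+1 in
    mod_lhs (@lm_op L M) h x m =
    \sum_(1 <= s < n.+1)
      \sum_(t : 'S_(size x) | unshuffle [:: (n - s)%N; s.-1] t)
        lm_op (take (n - s) (permute t x)) (h (drop (n - s) (permute t x)) m)
}.

Record linfty_mod_hom (L : linfty_alg) (M M' : linfty_mod L) :=
  LInftyModHom {
    mh_fun :> seq L -> M -> M';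
    mh_ax : is_linfty_mod_hom mh_fun
  }.

Definition mod_id (L : linfty_alg) (M : linfty_mod L) (x : seq L) (m : M) : M :=
  if x is [::] then m else 0.

Definition mod_comp (L : linfty_alg) (A B C : linfty_mod L)
    (g : seq L -> B -> C) (f : seq L -> A -> B) (x : seq L) (m : A) : C :=
  let n := (size x).+1 in
  \sum_(1 <= i < n.+1)
    \sum_(s : 'S_n | unshuffle [:: i; (n - i)%N] s
                     && (s (inord i.-1) == ord_max))
      g (drop i (permute s x)) (f (take i.-1 (permute s x)) m).

Record category := Category {
  ob :> Type;
  hom : ob -> ob -> Type;
  cid : forall a, hom a a;
  ccomp : forall a b c, hom b c -> hom a b -> hom a c;
  ccompA : forall a b c d (h : hom c d) (g : hom b c) (f : hom a b),
    ccomp h (ccomp g f) = ccomp (ccomp h g) f;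
  ccomp1f : forall a b (f : hom a b), ccomp (cid b) f = f;
  ccompf1 : forall a b (f : hom a b), ccomp f (cid a) = f
}.

Record is_functor (C D : category) (Fo : C -> D)
    (Fm : forall a b, hom a b -> hom (Fo a) (Fo b)) : Prop := IsFunctor {
  functor_id : forall a, Fm _ _ (cid a) = cid (Fo a);
  functor_comp : forall a b c (g : hom b c) (f : hom a b),
    Fm _ _ (ccomp g f) = ccomp (Fm _ _ g) (Fm _ _ f)
}.

(* [ssum x F] is the sum of F u v over all ways of splitting x into two
   complementary subsequences u and v. *)
Fixpoint ssum (T : Type) (V : nmodType) (x : seq T)
    (F : seq T -> seq T -> V) : V :=
  if x is a :: x' then
    ssum x' (fun u v => F (a :: u) v) + ssum x' (fun u v => F u (a :: v))
  else F [::] [::].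

Lemma eq_ssum_mem (T : eqType) (V : nmodType) (x : seq T)
    (F G : seq T -> seq T -> V) :
  (forall u v, {subset u <= x} -> {subset v <= x} -> F u v = G u v) ->
  ssum x F = ssum x G.
Proof.
elim: x F G => [|a x IH] F G eqFG /=; first exact: eqFG.
have subc w : {subset w <= x} -> {subset w <= a :: x}.
  by move=> sw b /sw; rewrite inE orbC => ->.
have subcc w : {subset w <= x} -> {subset a :: w <= a :: x}.
  by move=> sw b; rewrite !inE => /orP[->//|/sw ->]; rewrite orbT.
by congr (_ + _); apply: IH => u v su sv; apply: eqFG;
  do ?[exact: subc|exact: subcc].
Qed.

Lemma eq_ssum (T : Type) (V : nmodType) (x : seq T)
    (F G : seq T -> seq T -> V) :
  (forall u v, F u v = G u v) -> ssum x F = ssum x G.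
Proof.
elim: x F G => [|a x IH] F G eqFG /=; first exact: eqFG.
by congr (_ + _); apply: IH => u v.
Qed.

Lemma ssum0 (T : Type) (V : nmodType) (x : seq T) :
  ssum x (fun _ _ => 0 : V) = 0.
Proof. by elim: x => [//|a x IH] /=; rewrite IH addr0. Qed.

Lemma ssumD (T : Type) (V : nmodType) (x : seq T)
    (F G : seq T -> seq T -> V) :
  ssum x (fun u v => F u v + G u v) = ssum x F + ssum x G.
Proof.
by elim: x F G => [//|a x IH] F G /=; rewrite !IH addrACA.
Qed.

Lemma ssum_additive (T : Type) (V W : nmodType) (f : V -> W) (x : seq T)
    (F : seq T -> seq T -> V) :
  {morph f : u v / u + v} -> f (ssum x F) = ssum x (fun u v => f (F u v)).
Proof. by move=> fD; elim: x F => [//|a x IH] F /=; rewrite fD !IH. Qed.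

Lemma ssum_lin (T : Type) (V : lmodType 'F_2) (x : seq T) (a : 'F_2)
    (F G : seq T -> seq T -> V) :
  ssum x (fun u v => a *: F u v + G u v) = a *: ssum x F + ssum x G.
Proof.
by rewrite ssumD; congr (_ + _); rewrite (ssum_additive _ _ (scalerDr a)).
Qed.

Lemma ssum_map (T U : Type) (V : nmodType) (f : T -> U) (x : seq T)
    (F : seq U -> seq U -> V) :
  ssum (map f x) F = ssum x (fun u v => F (map f u) (map f v)).
Proof. by elim: x F => [//|a x IH] F /=; rewrite !IH. Qed.

Lemma ssum_cat (T : Type) (V : nmodType) (x y : seq T)
    (F : seq T -> seq T -> V) :
  ssum (x ++ y) F =
  ssum x (fun u v => ssum y (fun u' v' => F (u ++ u') (v ++ v'))).
Proof. by elim: x F => [//|a x IH] F /=; rewrite !IH. Qed.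

Lemma ssum_rcons (T : Type) (V : nmodType) (x : seq T) (a : T)
    (F : seq T -> seq T -> V) :
  ssum (rcons x a) F = ssum x (fun u v => F (rcons u a) v)
                     + ssum x (fun u v => F u (rcons v a)).
Proof.
rewrite -cats1 ssum_cat /= ssumD.
by congr (_ + _); apply: eq_ssum => u v; rewrite cats0 cats1.
Qed.

Lemma ssumC (T : Type) (V : nmodType) (x : seq T) (F : seq T -> seq T -> V) :
  ssum x F = ssum x (fun u v => F v u).
Proof.
elim: x F => [//|a x IH] F /=; rewrite addrC; congr (_ + _).
  exact: (IH (fun u v => F u (a :: v))).
exact: (IH (fun u v => F (a :: u) v)).
Qed.

Definition ssum3 (T : Type) (V : nmodType) (x : seq T)
    (F : seq T -> seq T -> seq T -> V) : V :=
  ssum x (fun u v => ssum v (F u)).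

Lemma eq_ssum3 (T : Type) (V : nmodType) (x : seq T)
    (F G : seq T -> seq T -> seq T -> V) :
  (forall u v w, F u v w = G u v w) -> ssum3 x F = ssum3 x G.
Proof. by move=> eqFG; apply: eq_ssum => u v; apply: eq_ssum. Qed.

Lemma ssum3D (T : Type) (V : nmodType) (x : seq T)
    (F G : seq T -> seq T -> seq T -> V) :
  ssum3 x (fun u v w => F u v w + G u v w) = ssum3 x F + ssum3 x G.
Proof. by rewrite -ssumD; apply: eq_ssum => u v; rewrite ssumD. Qed.

Lemma ssumA (T : Type) (V : nmodType) (x : seq T)
    (F : seq T -> seq T -> seq T -> V) :
  ssum x (fun u v => ssum u (fun a b => F a b v)) = ssum3 x F.
Proof.
elim: x F => [//|a x IH] F; rewrite /ssum3 /= !ssumD.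
rewrite (IH (fun u => F (a :: u))).
rewrite (IH (fun u b => F u (a :: b))) (IH (fun u b c => F u b (a :: c))).
by rewrite addrA.
Qed.

Lemma ssum3_swap12 (T : Type) (V : nmodType) (x : seq T)
    (F : seq T -> seq T -> seq T -> V) :
  ssum3 x F = ssum3 x (fun u v w => F v u w).
Proof. by rewrite -!ssumA; apply: eq_ssum => u v; rewrite ssumC. Qed.

Lemma ssum3_swap23 (T : Type) (V : nmodType) (x : seq T)
    (F : seq T -> seq T -> seq T -> V) :
  ssum3 x F = ssum3 x (fun u v w => F u w v).
Proof. by apply: eq_ssum => u v; rewrite ssumC. Qed.

Lemma ssum_exchange (T U : Type) (V : nmodType) (x : seq T) (y : seq U)
    (F : seq T -> seq T -> seq U -> seq U -> V) :
  ssum x (fun u v => ssum y (F u v)) =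
  ssum y (fun u' v' => ssum x (fun u v => F u v u' v')).
Proof. by elim: x F => [//|a x IH] F /=; rewrite !IH ssumD. Qed.

Lemma ssum_perm (T : eqType) (V : nmodType) (x y : seq T)
    (F : seq T -> seq T -> V) :
  (forall u u' v v', perm_eq u u' -> perm_eq v v' -> F u v = F u' v') ->
  perm_eq x y -> ssum x F = ssum y F.
Proof.
move=> Fsym pxy; pose P z := ssum x F = ssum z F.
apply: (@catCA_perm_ind _ P _ _ _ pxy) => // s1 s2 s3; rewrite /P => ->.
rewrite !ssum_cat.
under eq_ssum => u v do rewrite ssum_cat.
under [RHS]eq_ssum => u v do rewrite ssum_cat.
rewrite ssum_exchange; apply: eq_ssum => u v; apply: eq_ssum => u' v'.
by apply: eq_ssum => u'' v''; apply: Fsym; rewrite perm_catCA.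
Qed.

Fixpoint splits (T : Type) (x : seq T) : seq (seq T * seq T) :=
  if x is a :: x' then
    [seq (a :: uv.1, uv.2) | uv <- splits x']
    ++ [seq (uv.1, a :: uv.2) | uv <- splits x']
  else [:: ([::], [::])].

Lemma ssum_splits (T : Type) (V : nmodType) (x : seq T)
    (F : seq T -> seq T -> V) :
  ssum x F = \sum_(uv <- splits x) F uv.1 uv.2.
Proof.
elim: x F => [|a x IH] F /=; first by rewrite big_seq1.
by rewrite big_cat !big_map /= !IH.
Qed.

Lemma mem_splits (x : seq nat) (u v : seq nat) : sorted ltn x ->
  ((u, v) \in splits x) =
  [&& perm_eq (u ++ v) x, sorted ltn u & sorted ltn v].
Proof.
have pinj a : injective (fun uv : seq nat * seq nat => (a :: uv.1, uv.2)).
  by move=> [b1 b2] [c1 c2] /= [-> ->].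
have pinj' a : injective (fun uv : seq nat * seq nat => (uv.1, a :: uv.2)).
  by move=> [b1 b2] [c1 c2] /= [-> ->].
elim: x u v => [|a x IH] u v sx /=.
  rewrite inE; apply/eqP/idP => [[-> ->] //|].
  by case/and3P => /perm_nilP; case: u => // /=; case: v.
have {}IH := IH _ _ (path_sorted sx).
have ax : all (ltn a) x by apply: order_path_min sx; apply: ltn_trans.
have minP b w c : sorted ltn (b :: w) -> a \in b :: w ->
    perm_eq (b :: w ++ c) (a :: x) -> b = a.
  move=> sbw; rewrite inE => /orP[/eqP -> //|aw] /perm_mem /(_ b).
  rewrite !inE eqxx /= => /esym/orP[/eqP //|bx].
  have := order_path_min ltn_trans sbw => /allP/(_ _ aw) /= ltba.
  by move/allP: ax => /(_ _ bx) /= /ltn_trans/(_ ltba); rewrite ltnn.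
have sxc w : {subset w <= x} -> sorted ltn (a :: w) = sorted ltn w.
  move=> sw /=; rewrite path_sortedE; last exact: ltn_trans.
  by rewrite (_ : all _ _) //; apply/allP => b /sw; apply/allP.
rewrite mem_cat; apply/idP/idP.
  case/orP => /mapP[[u' v'] /=]; rewrite IH => /and3P[p su sv] [-> ->].
    have sub : {subset u' <= x}.
      by move=> b bu; rewrite -(perm_mem p) mem_cat bu.
    by move: (sxc _ sub) => /= ->; rewrite su sv perm_cons p.
  have sub : {subset v' <= x}.
    by move=> b bu; rewrite -(perm_mem p) mem_cat bu orbT.
  move: (sxc _ sub) => /= ->; rewrite su sv !andbT.
  by rewrite -cat1s perm_catCA perm_cons p.
case/and3P => p su sv.
have : a \in u ++ v by rewrite (perm_mem p) mem_head.
rewrite mem_cat => /orP[au|av].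
  case: u su au p => [//|b u] su au p; have eba := minP _ _ _ su au p.
  rewrite {}eba in su au p *.
  rewrite /= perm_cons in p.
  apply/orP; left; rewrite (mem_map (pinj a) _ (u, v)) IH p sv andbT.
  by rewrite (path_sorted su).
case: v sv av p => [//|b v] sv av p.
have p' : perm_eq (b :: v ++ u) (a :: x) by rewrite -cat_cons perm_catC.
have eba := minP _ _ _ sv av p'; rewrite {}eba in sv av p p' *.
rewrite perm_cons perm_catC in p'.
apply/orP; right; rewrite (mem_map (pinj' a) _ (u, v)) IH p' su.
by rewrite (path_sorted sv).
Qed.

Lemma uniq_splits (x : seq nat) : uniq x -> uniq (splits x).
Proof.
elim: x => [//|a x IH] /= /andP[nax ux].
rewrite cat_uniq !map_inj_uniq ?IH //; first last.
- by move=> [b1 b2] [c1 c2] /= [-> ->].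
- by move=> [b1 b2] [c1 c2] /= [-> ->].
rewrite andbT; apply/hasPn => _ /mapP[[u v] uv ->] /=.
apply/mapP => -[[u' v'] _ /= [eu _]].
suff sub : forall (y : seq nat) u v, (u, v) \in splits y -> {subset u <= y}.
  by move/negP: nax; apply; apply: (sub _ _ _ uv); rewrite eu mem_head.
elim=> [|b y IHy] u1 v1 /=; first by rewrite inE => /eqP[-> _].
rewrite mem_cat => /orP[] /mapP[[u2 v2] /IHy s1 [-> _]] c /=; rewrite !inE.
  by case/orP => [->//|/s1 ->]; rewrite orbT.
by move/s1 => ->; rewrite orbT.
Qed.


Lemma size_oneline n (s : 'S_n) : size (oneline s) = n.
Proof. by rewrite size_map size_enum_ord. Qed.

Lemma nth_oneline n (s : 'S_n) (i : 'I_n) : nth 0%N (oneline s) i = s i.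
Proof.
by rewrite /oneline (nth_map i) ?size_enum_ord ?ltn_ord // nth_ord_enum.
Qed.

Lemma oneline_inj n : injective (@oneline n).
Proof.
by move=> s t e; apply/permP => i; apply/val_inj; rewrite /= -!nth_oneline e.
Qed.

Lemma perm_oneline n :
  perm_eq [seq oneline s | s <- enum 'S_n] (permutations (iota 0 n)).
Proof.
have us : uniq [seq oneline s | s <- enum {: 'S_n}].
  by rewrite (map_inj_uniq (@oneline_inj n)) enum_uniq.
apply: (uniq_perm us (permutations_uniq _)).
apply: (fun a b => (uniq_min_size us a b).2).
  move=> _ /mapP[s _ ->]; rewrite mem_permutations.
  have uo : uniq (oneline s).
    by rewrite map_inj_uniq ?enum_uniq // => i j /val_inj /perm_inj.
  apply: (uniq_perm uo (iota_uniq _ _)).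
  apply: (fun a b => (uniq_min_size uo a b).2); last first.
    by rewrite size_oneline size_iota.
  by move=> _ /mapP[i _ ->]; rewrite mem_iota /=.
by rewrite size_permutations ?iota_uniq // size_iota size_map -cardE card_Sn.
Qed.

Lemma unshuffle2 n p (s : 'S_n) : (p <= n)%N ->
  unshuffle [:: p; (n - p)%N] s =
  sorted ltn (take p (oneline s)) && sorted ltn (drop p (oneline s)).
Proof.
move=> lpn; rewrite /unshuffle /= addn0 subnKC // eqxx /= andbT.
by rewrite (take_oversize (n := (n - p)%N)) // size_drop size_oneline.
Qed.

Lemma sum_unshuffle (V : nmodType) n (G : seq nat -> seq nat -> V) :
  \sum_(0 <= p < n.+1) \sum_(s : 'S_n | unshuffle [:: p; (n - p)%N] s)
     G (take p (oneline s)) (drop p (oneline s)) = ssum (iota 0 n) G.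
Proof.
pose pairs := [seq (take p w, drop p w) | p <- iota 0 n.+1,
  w <- [seq w <- permutations (iota 0 n) |
         sorted ltn (take p w) && sorted ltn (drop p w)]].
transitivity (\sum_(uv <- pairs) G uv.1 uv.2).
  rewrite big_allpairs_dep; apply: eq_big_seq => p.
  rewrite mem_index_iota /= ltnS => lpn; rewrite big_filter -(perm_big _ (perm_oneline n)).
  rewrite big_map big_enum_cond /=; apply: eq_bigl => s.
  by rewrite unshuffle2.
rewrite ssum_splits; apply: perm_big => /=.
have sz (w : seq nat) : w \in permutations (iota 0 n) -> size w = n.
  by rewrite mem_permutations => /perm_size ->; rewrite size_iota.
apply: uniq_perm; [|exact: uniq_splits (iota_uniq _ _)|].
  apply: allpairs_uniq_dep => [|p _|]; first exact: iota_uniq.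
    by rewrite filter_uniq ?permutations_uniq.
  move=> _ _ /allpairsPdep[p [w [pn wP ->]]] /allpairsPdep[q [z [qn zP ->]]] /=.
  move: pn qn wP zP; rewrite !mem_iota !mem_filter !ltnS /= => lp lq.
  move=> /andP[_ /sz sw] /andP[_ /sz sz'] [e1 e2].
  have e3 : p = q by have := congr1 size e1; rewrite !size_takel ?sw ?sz'.
  by subst q; rewrite -(cat_take_drop p w) e1 e2 cat_take_drop.
move=> [u v]; rewrite mem_splits ?iota_ltn_sorted //.
apply/allpairsPdep/idP => [[p [w [pn]]]|/and3P[puv su sv]].
  rewrite mem_filter mem_permutations => /andP[/andP[s1 s2] pw] [-> ->].
  by rewrite cat_take_drop pw s1 s2.
exists (size u), (u ++ v); rewrite take_size_cat // drop_size_cat //.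
rewrite mem_filter mem_permutations take_size_cat // drop_size_cat //.
rewrite su sv puv mem_iota /= add0n ltnS; split=> //.
by rewrite -[leqRHS](size_iota 0 n) -(perm_size puv) size_cat leq_addr.
Qed.

Lemma last_iota_notin n (v : seq nat) : {subset v <= iota 0 n} ->
  (v != [::]) && (last 0%N v == n) = false.
Proof.
case: v => [//|a v] sv /=; apply/negP => /eqP e.
by have := sv n; rewrite -{1}e mem_last mem_iota ltnn => /(_ isT).
Qed.

Lemma iota_rcons n : iota 0 n.+1 = rcons (iota 0 n) n.
Proof. by rewrite -addn1 iotaD cats1. Qed.

Lemma sum_unshuffle_last (V : nmodType) N (G : seq nat -> seq nat -> V) :
  \sum_(1 <= p < N.+2)
    \sum_(s : 'S_N.+1 | unshuffle [:: p; (N.+1 - p)%N] s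
                         && (s (inord p.-1) == ord_max))
      G (take p.-1 (oneline s)) (drop p (oneline s)) = ssum (iota 0 N) G.
Proof.
pose G' u v : V := if (u != [::]) && (last 0%N u == N) then
                    G (take (size u).-1 u) v else 0.
have := sum_unshuffle N.+1 G'; rewrite iota_rcons ssum_rcons.
rewrite [X in _ + X](_ : _ = 0) ?addr0; last first.
  rewrite -[RHS](@ssum0 _ _ (iota 0 N)); apply: eq_ssum_mem => u v su _.
  by rewrite /G' last_iota_notin.
rewrite (_ : ssum _ _ = ssum (iota 0 N) G); last first.
  apply: eq_ssum => u v; rewrite /G' last_rcons eqxx andbT.
  rewrite -size_eq0 size_rcons /= -cats1 take_size_cat //.
move=> <-; rewrite [RHS]big_nat_recl // [X in _ = X + _]big1 ?add0r; last first.
  by move=> s _; rewrite /G' take0.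
rewrite big_add1 /=; apply: eq_big_nat => p /andP[_ lpN].
rewrite big_mkcondr; apply: eq_bigr => s _ /=.
have szt : size (take p.+1 (oneline s)) = p.+1.
  by rewrite size_takel ?size_oneline.
rewrite /G' -size_eq0 szt /= -(nth_last 0%N) szt /= nth_take // take_takel ?leqnSn //.
rewrite -[in RHS](@inordK N p) // nth_oneline.
by rewrite -(inj_eq val_inj) /= !inordK.
Qed.

Lemma sum_unshuffle_first (V : nmodType) N (G : seq nat -> seq nat -> V) :
  \sum_(1 <= p < N.+1)
    \sum_(s : 'S_N.+1 | unshuffle [:: p; (N.+1 - p)%N] s
                         && (s ord_max == ord_max))
      G (take p (oneline s)) (drop p (take N (oneline s)))
  = ssum (iota 0 N) (fun u v => if u is [::] then 0 else G u v).
Proof.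
pose G' u v : V := if (v != [::]) && (last 0%N v == N) then
                    if u is [::] then 0 else G u (take (size v).-1 v) else 0.
have := sum_unshuffle N.+1 G'; rewrite iota_rcons ssum_rcons.
rewrite [X in X + _](_ : _ = 0) ?add0r; last first.
  rewrite -[RHS](@ssum0 _ _ (iota 0 N)); apply: eq_ssum_mem => u v _ sv.
  by rewrite /G' last_iota_notin.
rewrite (_ : ssum _ _ =
  ssum (iota 0 N) (fun u v => if u is [::] then 0 else G u v)); last first.
  apply: eq_ssum => u v; rewrite /G' last_rcons eqxx andbT.
  by rewrite -size_eq0 size_rcons /= -cats1 take_size_cat.
move=> <-; rewrite [RHS]big_nat_recl // [X in _ = X + _]big1 ?add0r; last first.
  by move=> s _; rewrite /G' take0; case: ifP.
rewrite [RHS]big_nat_recr //= [X in _ = _ + X]big1 ?addr0; last first.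
  by move=> s _; rewrite /G' drop_oversize ?size_oneline.
rewrite big_add1 /=; apply: eq_big_nat => p /andP[_ lpN].
rewrite big_mkcondr; apply: eq_bigr => s _ /=.
have szd : size (drop p.+1 (oneline s)) = (N - p)%N.
  by rewrite size_drop size_oneline subSS.
have szt : size (take p.+1 (oneline s)) = p.+1.
  by rewrite size_takel ?size_oneline // ltnW.
rewrite /G' -size_eq0 szd subn_eq0 leqNgt lpN /= -(nth_last 0%N) szd nth_drop.
rewrite (_ : (p.+1 + (N - p).-1)%N = (ord_max : 'I_N.+1) :> nat); last first.
  by rewrite /= addSnnS prednK ?subn_gt0 // subnKC // ltnW.
rewrite nth_oneline -(inj_eq val_inj) /=.
case: ifP => // _; move: szt; case: (take p.+1 _) => // a w _.
by rewrite take_drop [(_ + p.+1)%N]addnC addSnnS prednK ?subn_gt0 // subnKC // ltnW.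
Qed.

Lemma map_nth_iota_id (V : nmodType) (x : seq V) :
  [seq x`_i | i <- iota 0 (size x)] = x.
Proof. exact: mkseq_nth. Qed.

Lemma take_permute (V : nmodType) n (s : 'S_n) (x : seq V) p :
  take p (permute s x) = [seq x`_i | i <- take p (oneline s)].
Proof. by rewrite map_take. Qed.

Lemma drop_permute (V : nmodType) n (s : 'S_n) (x : seq V) p :
  drop p (permute s x) = [seq x`_i | i <- drop p (oneline s)].
Proof. by rewrite map_drop. Qed.

Lemma mod_lhsE (L : linfty_alg) (M N : gvect) (k : seq L -> M -> M)
    (g : seq L -> M -> N) (x : seq L) (m : M) :
  mod_lhs k g x m =
  ssum x (fun u v => if u is [::] then 0 else g (la_op u :: v) m)
  + ssum x (fun u v => g v (k u m)).
Proof.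
rewrite -[in RHS](map_nth_iota_id x) !ssum_map /mod_lhs; congr (_ + _).
  rewrite [RHS](_ : _ = ssum (iota 0 (size x)) (fun u v =>
     if u is [::] then 0 else g (la_op (map (nth 0 x) u) :: map (nth 0 x) v) m)).
    rewrite -sum_unshuffle_first; apply: eq_bigr => p _; apply: eq_bigr => s _.
    by rewrite !take_permute -map_drop.
  by apply: eq_ssum => -[|a u] v.
rewrite -(sum_unshuffle_last (size x)
  (fun u v => g (map (nth 0 x) v) (k (map (nth 0 x) u) m))).
apply: eq_bigr => p _; apply: eq_bigr => s _.
by rewrite take_permute drop_permute.
Qed.

Lemma mod_compE (L : linfty_alg) (A B C : linfty_mod L)
    (g : seq L -> B -> C) (f : seq L -> A -> B) (x : seq L) (m : A) :
  mod_comp g f x m = ssum x (fun u v => g v (f u m)).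
Proof.
rewrite -[in RHS](map_nth_iota_id x) ssum_map.
rewrite -(sum_unshuffle_last (size x)
  (fun u v => g (map (nth 0 x) v) (f (map (nth 0 x) u) m))).
apply: eq_bigr => p _; apply: eq_bigr => s _.
by rewrite take_permute drop_permute.
Qed.

Lemma mod_rhsE (L : linfty_alg) (M N : gvect) (k : seq L -> N -> N)
    (h : seq L -> M -> N) (x : seq L) (m : M) :
  let n := (size x).+1 in
  \sum_(1 <= s < n.+1)
    \sum_(t : 'S_(size x) | unshuffle [:: (n - s)%N; s.-1] t)
      k (take (n - s) (permute t x)) (h (drop (n - s) (permute t x)) m)
  = ssum x (fun u v => k u (h v m)).
Proof.
move=> n; rewrite -[in RHS](map_nth_iota_id x) ssum_map -sum_unshuffle.
rewrite big_add1 /= big_nat_rev /=; apply: eq_big_nat => p /andP[_ lpn].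
have -> : (0 + (size x).+1 - p.+1 = size x - p)%N by rewrite add0n subSS.
have -> : (n - (size x - p).+1 = p)%N by rewrite subSS subKn.
by apply: eq_bigr => s _; rewrite /permute -map_take -map_drop.
Qed.


Lemma symmetric_permP (U : nmodType) (T : Type) (f : seq U -> T) :
  symmetric_maps f <-> (forall x y, perm_eq x y -> f x = f y).
Proof.
have permuteE (x : seq U) (s : 'S_(size x)) :
    permute s x = [tuple tnth (in_tuple x) (s i) | i < size x].
  rewrite /permute /oneline -map_comp /=; apply: eq_map => i /=.
  by rewrite (tnth_nth 0).
split=> [symf x y|symf x s].
  rewrite -[y]/(val (in_tuple y)) => /tuple_permP[s ->].
  by rewrite -permuteE symf.
apply: symf; rewrite permuteE.
by apply/(@tuple_permP _ _ _ (in_tuple x)); exists s.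
Qed.

Lemma ssum_multilinear (U V : lmodType 'F_2) (F : seq U -> seq U -> V) :
  (forall v, multilinear (F^~ v)) -> (forall u, multilinear (F u)) ->
  multilinear (fun x => ssum x F).
Proof.
move=> linl linr s1 s2 a u v; rewrite !ssum_cat -ssum_lin.
apply: eq_ssum => u1 v1 /=; rewrite scalerDr addrACA -!ssum_lin.
by congr (_ + _); apply: eq_ssum => u2 v2; rewrite ?linl ?linr.
Qed.

Lemma homogeneous_cons (V : gvect) d ds (a : V) x :
  homogeneous (d :: ds) (a :: x) <-> homog d a /\ homogeneous ds x.
Proof.
split=> [[/= [sz] h]|[ha [sz h]]].
  by split; [exact: (h 0%N)|split=> // i; exact: (h i.+1)].
by split=> [/=|[|i]]; [rewrite sz|move=> _|exact: h].
Qed.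

Lemma homogD (V : gvect) d (u v : V) : homog d u -> homog d v -> homog d (u + v).
Proof.
by move=> hu hv; rewrite -[u]scale1r; apply: (gradingP (gv_grading V)).
Qed.

Lemma homog_ssum (U V : gvect) (e : int) ds (x : seq U)
    (F : seq U -> seq U -> V) :
  homogeneous ds x ->
  (forall ds1 ds2 u v, homogeneous ds1 u -> homogeneous ds2 v ->
     \sum_(d <- ds1) d + \sum_(d <- ds2) d = \sum_(d <- ds) d ->
     (size u + size v = size x)%N -> homog e (F u v)) ->
  homog e (ssum x F).
Proof.
elim: x ds F => [|a x IH] [|d ds] F hx hF; try by case: hx.
  by apply: (hF [::] [::]); rewrite // !big_nil addr0.
have [ha {}hx] := (homogeneous_cons _ _ _ _).1 hx.
apply: homogD; apply: (IH ds) => // ds1 ds2 u v h1 h2 e1 e2.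
  apply: (hF (d :: ds1) ds2); rewrite ?homogeneous_cons //.
    by rewrite !big_cons -addrA e1.
  by rewrite /= addSn e2.
apply: (hF ds1 (d :: ds2)); rewrite ?homogeneous_cons //.
  by rewrite !big_cons addrCA e1.
by rewrite /= addnS e2.
Qed.

Section ModCategory.
Variable L : linfty_alg.

Lemma modmapD (A B : lmodType 'F_2) (g : seq L -> A -> B) x :
  multilinear_mod g -> {morph g x : u v / u + v}.
Proof. by case=> _ lin u v; have := lin x 1 u v; rewrite !scale1r. Qed.

Lemma modmap0 (A B : lmodType 'F_2) (g : seq L -> A -> B) x :
  multilinear_mod g -> g x 0 = 0.
Proof.
move=> lin; have := modmapD x lin 0 0; rewrite addr0.
by move/(congr1 (fun z => z - g x 0)); rewrite subrr addrK => <-.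
Qed.

Lemma mod_id_hom (M : linfty_mod L) : is_linfty_mod_hom (@mod_id L M).
Proof.
have [kml _ _ _] := lm_ax M.
split.
- split=> [m s1 s2 a u v|[|b x] a u v] //; last by rewrite /= scaler0 addr0.
  by case: s1 => [|? ?]; rewrite /= scaler0 addr0.
- by move=> m; apply/symmetric_permP => -[|a x] [|b y] // /perm_size.
- move=> ds e [|a x] m [sz hx] hm /=; last exact: (grading0 (gv_grading M)).
  by case: ds sz {hx} => // _; rewrite big_nil add0r subrr addr0.
- move=> x m; cbv zeta; rewrite mod_lhsE mod_rhsE.
  rewrite [X in X + _](_ : _ = 0) ?add0r; last first.
    by rewrite -[RHS](ssum0 _ x); apply: eq_ssum => -[|a u] v.
  by apply: eq_ssum => u [|b v] //=; rewrite modmap0.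
Qed.

Lemma mod_comp_hom (A B C : linfty_mod L) (g : linfty_mod_hom B C)
    (f : linfty_mod_hom A B) : is_linfty_mod_hom (mod_comp g f).
Proof.
have [gml gsym gdeg grel] := mh_ax g; have [fml fsym fdeg frel] := mh_ax f.
have gs v v' m : perm_eq v v' -> g v m = g v' m.
  exact: (symmetric_permP (g^~ m)).1.
have fs v v' m : perm_eq v v' -> f v m = f v' m.
  exact: (symmetric_permP (f^~ m)).1.
have [kml ksym kdeg krel] := lm_ax C.
have compE := mod_compE g f.
split.
- split=> [m|x a u v]; last first.
    rewrite !compE -ssum_lin; apply: eq_ssum => y z.
    by rewrite fml.2 gml.2.
  have -> : (mod_comp g f)^~ m = fun x => ssum x (fun u v => g v (f u m)).
    by apply: funext => x; rewrite compE.
  apply: ssum_multilinear => [v|u]; last exact: gml.1.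
  by move=> s1 s2 a x y; rewrite fml.1 gml.2.
- move=> m; apply/symmetric_permP => x y pxy; rewrite !compE.
  apply: ssum_perm pxy => u u' v v' pu pv.
  by rewrite (fs _ _ _ pu); apply: gs.
- move=> ds e x m hx hm; rewrite compE; apply: homog_ssum hx _.
  move=> ds1 ds2 u v hu hv e1 e2.
  have hf := fdeg _ _ _ _ hu hm; have := gdeg _ _ _ _ hv hf.
  congr homog; rewrite -e1 -e2 !intS !PoszD.
  by ring.
- move=> x m; cbv zeta; rewrite mod_lhsE mod_rhsE.
  have rel_g w y : ssum w (fun u v => lm_op u (g v y)) =
      ssum w (fun u v => if u is [::] then 0 else g (la_op u :: v) y)
      + ssum w (fun u v => g v (lm_op u y)).
    by have := grel w y; cbv zeta; rewrite mod_lhsE mod_rhsE.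
  have rel_f w : ssum w (fun u v => lm_op u (f v m)) =
      ssum w (fun u v => if u is [::] then 0 else f (la_op u :: v) m)
      + ssum w (fun u v => f v (lm_op u m)).
    by have := frel w m; cbv zeta; rewrite mod_lhsE mod_rhsE.
  transitivity
    (ssum3 x (fun a u c => if u is [::] then 0 else g (la_op u :: c) (f a m))
     + (ssum3 x (fun c u a =>
          if u is [::] then 0 else g c (f (la_op u :: a) m))
        + ssum3 x (fun c u a => g c (f a (lm_op u m))))).
    rewrite [X in X + _ = _](_ : _ =
      ssum3 x (fun u a c => if u is [::] then 0 else g c (f (la_op u :: a) m))
      + ssum3 x (fun u a c =>
          if u is [::] then 0 else g (la_op u :: c) (f a m))); last first.
      rewrite -ssumD; apply: eq_ssum => -[|b u] v; first by rewrite !ssum0 addr0.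
      by rewrite compE.
    rewrite [X in _ + X = _](_ : _ =
      ssum3 x (fun u a c => g c (f a (lm_op u m)))); last first.
      by apply: eq_ssum => u v; rewrite compE.
    rewrite addrA; congr (_ + _); last by rewrite ssum3_swap23 ssum3_swap12.
    by rewrite addrC; congr (_ + _); [|rewrite ssum3_swap23]; rewrite ssum3_swap12.
  rewrite [RHS](_ : _ = ssum3 x (fun u a c => lm_op u (g c (f a m)))); last first.
    apply: eq_ssum => u v.
    by rewrite compE (ssum_additive _ _ (modmapD u kml)).
  rewrite [RHS]ssum3_swap12 [RHS](_ : _ =
    ssum3 x (fun a u c => if u is [::] then 0 else g (la_op u :: c) (f a m))
    + ssum3 x (fun a u c => g c (lm_op u (f a m)))); last first.
    by rewrite -ssumD; apply: eq_ssum => a w; apply: rel_g.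
  congr (_ + _); rewrite [RHS]ssum3_swap12 [RHS]ssum3_swap23 [RHS]ssum3_swap12.
  rewrite -ssumD; apply: eq_ssum => c w /=.
  rewrite -(ssum_additive w (fun u a => lm_op u (f a m)) (modmapD c gml)).
  rewrite rel_f modmapD //.
  rewrite !(ssum_additive _ _ (modmapD c gml)); congr (_ + _).
  by apply: eq_ssum => -[|b u] a //; rewrite modmap0.
Qed.

Definition mod_hom_id (M : linfty_mod L) : linfty_mod_hom M M :=
  LInftyModHom (mod_id_hom M).

Definition mod_hom_comp (A B C : linfty_mod L) (g : linfty_mod_hom B C)
    (f : linfty_mod_hom A B) : linfty_mod_hom A C :=
  LInftyModHom (mod_comp_hom g f).

Lemma mod_hom_ext (A B : linfty_mod L) (f g : linfty_mod_hom A B) :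
  (forall x m, f x m = g x m) -> f = g.
Proof.
case: f g => [f fax] [g gax] /= eqfg.
have e : f = g by apply: funext => x; apply: funext => m.
by subst g; congr LInftyModHom; apply: Prop_irrelevance.
Qed.

Lemma mod_hom_compA (A B C D : linfty_mod L) (h : linfty_mod_hom C D)
    (g : linfty_mod_hom B C) (f : linfty_mod_hom A B) :
  mod_hom_comp h (mod_hom_comp g f) = mod_hom_comp (mod_hom_comp h g) f.
Proof.
have [hml _ _ _] := mh_ax h.
apply: mod_hom_ext => x m /=; rewrite !mod_compE.
under [RHS]eq_ssum => u v do rewrite mod_compE.
rewrite -[RHS]/(ssum3 x (fun u b c => h c (g b (f u m)))) -ssumA.
apply: eq_ssum => u v.
by rewrite mod_compE (ssum_additive _ _ (modmapD v hml)).
Qed.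

Lemma mod_hom_comp1f (A B : linfty_mod L) (f : linfty_mod_hom A B) :
  mod_hom_comp (mod_hom_id B) f = f.
Proof.
apply: mod_hom_ext => x m /=; rewrite mod_compE.
elim: x (f : seq L -> A -> B) => [//|a x IH] h /=.
rewrite (IH (fun u => h (a :: u))) -[RHS]addr0; congr (_ + _).
exact: ssum0.
Qed.

Lemma mod_hom_compf1 (A B : linfty_mod L) (f : linfty_mod_hom A B) :
  mod_hom_comp f (mod_hom_id A) = f.
Proof.
have [fml _ _ _] := mh_ax f.
apply: mod_hom_ext => x m /=; rewrite mod_compE.
elim: x (f : seq L -> A -> B) fml => [//|a x IH] h hml /=.
rewrite [X in X + _](_ : _ = 0) ?add0r.
  apply: (IH (fun u => h (a :: u))); split=> [m' s1 s2|x']; last exact: hml.2.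
  exact: (hml.1 m' (a :: s1) s2).
by rewrite -[RHS](ssum0 _ x); apply: eq_ssum => u v; rewrite modmap0.
Qed.

End ModCategory.

Definition Lmod (L : linfty_alg) : category :=
  Category (@mod_hom_compA L) (@mod_hom_comp1f L) (@mod_hom_compf1 L).

Definition restr (L' L : linfty_alg) (I : seq L' -> L) (M N : gvect)
    (g : seq L -> M -> N) (x : seq L') (m : M) : N :=
  if x is [::] then g [::] m else sum_S' x (fun bs => g (map I bs) m).

(* Main.v *)
Require Import Defs.
From mathcomp Require Import all_boot all_order all_algebra all_fingroup.
From mathcomp Require Import boolp ring zify.

(** The sum over all S'(i_1,...,i_r) is a sum over set partitions: an element
    of S' cuts the inputs x_1, ..., x_n into nonempty blocks, each in
    increasing order, and the conditions on S' pick out exactly one order of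
    the blocks (by size, then by first entry) for each set partition.  A summand
    that is symmetric in the blocks does not see this order, so the blocks may
    as well be listed by their first entries (sum_S'E).  The resulting sum
    [psum] obeys a recurrence (psum_cons): choose the block of the first input,
    then partition the remaining inputs.

    With [ssum] summing over the ways of splitting a sequence in two, two facts
    carry the proof.  Restriction sends a family g to
    x |-> psum x (g o I^{(x)r}), that is, to the composite of g with the
    coalgebra map E : S(L') -> S(L) whose components are the I_n.
    - E commutes with the coproduct (psum_ssum): splitting the set of blocks in
      two and partitioning each half of a splitting of the inputs are the same
      choice.  Hence restriction commutes with every expression of the form
      sum g(v, k(u, m)) (ssum_restr), in particular with composition of module
      homomorphisms and with the right-hand side of their relation.
    - E commutes with the codifferentials (this is the argument in
      mod_lhs_restr).  Applying l to some of the blocks amounts, by the relation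
      defining I (psum_la_op), to applying l' to some of the inputs of the union
      of these blocks and then I to the result and the rest of the union; by the
      recurrence, this is a partition of the inputs with l'(u) as a new first
      input.
    So either side of a module relation, or of a homomorphism relation, for the
    restricted maps at x is the [psum] of that side for the original
    maps at the images of the blocks, and the relations are inherited. *)

Set Implicit Arguments.
Unset Strict Implicit.
Unset Printing Implicit Defensive.

Import GRing.Theory.
Local Open Scope ring_scope.

(** * Sums over set partitions *)

Lemma mem_splits_size (T : eqType) (x : seq T) uv :
  uv \in splits x -> (size uv.1 + size uv.2 = size x)%N.
Proof.
elim: x uv => [|a x IH] uv /=; first by rewrite inE => /eqP ->.
by rewrite mem_cat => /orP[] /mapP[[u v] /IH /= <- ->] //=; rewrite addnS.
Qed.

Lemma eq_ssum_size (T : eqType) (V : nmodType) (x : seq T)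
    (F G : seq T -> seq T -> V) :
  (forall u v, (size u + size v = size x)%N -> F u v = G u v) ->
  ssum x F = ssum x G.
Proof.
move=> eqFG; rewrite !ssum_splits; apply: eq_big_seq => uv /mem_splits_size.
exact: eqFG.
Qed.

(** The blocks of a partition are listed by the position of their first entry,
    so the first block consists of the first entry of [x] and of one half of a
    splitting of the rest.  The number [n] bounds the recursion, which is on the
    other half; on sequences longer than [n] the result is a junk value. *)
Fixpoint set_partitions_rec (T : Type) (n : nat) (x : seq T) :
    seq (seq (seq T)) :=
  match x, n with
  | [::], _ => [:: [::]]
  | _, 0 => [::]
  | a :: x', n'.+1 =>
      [seq (a :: uv.1) :: bs | uv <- splits x',
                               bs <- set_partitions_rec n' uv.2]
  end.

Definition set_partitions (T : Type) (x : seq T) : seq (seq (seq T)) :=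
  set_partitions_rec (size x) x.

Definition psum (T : Type) (V : nmodType) (x : seq T) (F : seq (seq T) -> V) :
    V :=
  \sum_(bs <- set_partitions x) F bs.

Lemma set_partitions_rec_fuel (T : eqType) n (x : seq T) :
  (size x <= n)%N -> set_partitions_rec n x = set_partitions x.
Proof.
rewrite /set_partitions; have [k] := ubnP (size x).
elim: k n x => // k IH [|n] [|a x] //= ltxk lexn.
congr flatten; apply/eq_in_map => -[u v] /mem_splits_size /= szuv.
by rewrite (IH n) ?(IH (size x)) //; lia.
Qed.

Lemma set_partitions_cons (T : eqType) a (x : seq T) :
  set_partitions (a :: x) =
  [seq (a :: uv.1) :: bs | uv <- splits x, bs <- set_partitions uv.2].
Proof.
congr flatten; apply/eq_in_map => -[u v] /mem_splits_size /= szuv.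
congr map; apply: set_partitions_rec_fuel; rewrite -/(size x); lia.
Qed.

Lemma psum_nil (T : Type) (V : nmodType) (F : seq (seq T) -> V) :
  psum [::] F = F [::].
Proof. exact: big_seq1. Qed.

(** Choose the other entries [u] of the block of [a], then partition the
    rest. *)
Lemma psum_cons (T : eqType) (V : nmodType) a (x : seq T)
    (F : seq (seq T) -> V) :
  psum (a :: x) F = ssum x (fun u v => psum v (fun bs => F ((a :: u) :: bs))).
Proof. by rewrite /psum set_partitions_cons big_allpairs_dep ssum_splits. Qed.

Lemma eq_psum (T : Type) (V : nmodType) (x : seq T) (F G : seq (seq T) -> V) :
  (forall bs, F bs = G bs) -> psum x F = psum x G.
Proof. by move=> eqFG; apply: eq_bigr => bs _. Qed.

Lemma eq_psum_cons (T : eqType) (V : nmodType) a (x : seq T)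
    (F G : seq (seq T) -> V) :
  (forall b bs, F (b :: bs) = G (b :: bs)) -> psum (a :: x) F = psum (a :: x) G.
Proof.
by move=> eqFG; rewrite !psum_cons; apply: eq_ssum => u v; apply: eq_psum.
Qed.

Lemma psumD (T : Type) (V : nmodType) (x : seq T) (F G : seq (seq T) -> V) :
  psum x (fun bs => F bs + G bs) = psum x F + psum x G.
Proof. exact: big_split. Qed.

Lemma psum0 (T : Type) (V : nmodType) (x : seq T) :
  psum x (fun _ => 0 : V) = 0.
Proof. exact: big1. Qed.

Lemma psum_additive (T : Type) (V W : nmodType) (f : V -> W) (x : seq T)
    (F : seq (seq T) -> V) :
  f 0 = 0 -> {morph f : u v / u + v} ->
  f (psum x F) = psum x (fun bs => f (F bs)).
Proof. by move=> f0 fD; apply: big_morph. Qed.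

Lemma psum_ssumC (T U : Type) (V : nmodType) (x : seq T) (y : seq U)
    (F : seq (seq T) -> seq U -> seq U -> V) :
  psum x (fun bs => ssum y (F bs)) =
  ssum y (fun u v => psum x (fun bs => F bs u v)).
Proof.
rewrite ssum_splits /psum exchange_big /=; apply: eq_bigr => bs _.
exact: ssum_splits.
Qed.

Lemma psum_map (T U : eqType) (V : nmodType) (f : T -> U) (x : seq T)
    (F : seq (seq U) -> V) :
  psum (map f x) F = psum x (fun bs => F (map (map f) bs)).
Proof.
have [n] := ubnP (size x); elim: n x F => // n IH [|a x] F ltxn.
  by rewrite !psum_nil.
rewrite [map _ _]/= !psum_cons ssum_map; apply: eq_ssum_size => u v szuv.
by rewrite IH //; move: ltxn => /=; lia.
Qed.

(** Both sides sum over the set partitions of [x] with blocks coloured in two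
    colours: the colouring of the blocks induces one of the entries. *)
Lemma psum_ssum (T : eqType) (V : nmodType) (x : seq T)
    (G : seq (seq T) -> seq (seq T) -> V) :
  psum x (fun bs => ssum bs G) =
  ssum x (fun u v => psum u (fun bs => psum v (G bs))).
Proof.
have [n] := ubnP (size x); elim: n x G => // n IH [|a x] G ltxn.
  by rewrite /= !psum_nil.
rewrite psum_cons /=; under eq_ssum => u v do rewrite psumD.
rewrite ssumD; congr (_ + _).
  under [RHS]eq_ssum => u v do rewrite psum_cons.
  rewrite [RHS](ssumA _ (fun u v w =>
    psum v (fun bs => psum w (G ((a :: u) :: bs))))).
  by apply: eq_ssum_size => u v szuv; rewrite IH //; move: ltxn => /=; lia.
under [RHS]eq_ssum => u v.
  under eq_psum => bs do rewrite psum_cons.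
  rewrite psum_ssumC.
  over.
rewrite -/(ssum3 x (fun u v w =>
  psum u (fun bs => psum w (fun cs => G bs ((a :: v) :: cs))))) ssum3_swap12.
apply: eq_ssum_size => u v szuv.
rewrite (IH _ (fun bs cs => G bs ((a :: u) :: cs))) //.
by move: ltxn => /=; lia.
Qed.

(** * The sums over S' are sums over set partitions *)

Lemma perm_sorted_eq (B : eqType) (key : B -> nat) (s t : seq B) :
  sorted ltn (map key s) -> sorted ltn (map key t) -> perm_eq s t -> s = t.
Proof.
rewrite !sorted_map => ss st /perm_mem; apply: irr_sorted_eq ss st.
  by move=> b c d; apply: ltn_trans.
by move=> b; apply: ltnn.
Qed.

(** A sum over finite sets of elements of [B], each set being listed in
    the order of its keys, does not depend on the choice of the key:
    sorting by the other key is a bijection between the two index lists. *)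
Lemma big_resort (B : eqType) (V : nmodType) (key1 key2 : B -> nat)
    (Q : pred (seq B)) (S1 S2 : seq (seq B)) (F : seq B -> V) :
  (forall s t, perm_eq s t -> Q s -> Q t) ->
  (forall s, Q s -> uniq (map key1 s)) ->
  (forall s, Q s -> uniq (map key2 s)) ->
  uniq S1 -> (forall s, (s \in S1) = Q s && sorted ltn (map key1 s)) ->
  uniq S2 -> (forall s, (s \in S2) = Q s && sorted ltn (map key2 s)) ->
  (forall s t, perm_eq s t -> F s = F t) ->
  \sum_(s <- S1) F s = \sum_(s <- S2) F s.
Proof.
move=> Qperm Quniq1 Quniq2 uS1 memS1 uS2 memS2 Fperm.
pose srt (key : B -> nat) := sort (relpre key leq).
have perm_srt key s : perm_eq (srt key s) s by rewrite perm_sort.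
have sorted_srt key s : uniq (map key s) -> sorted ltn (map key (srt key s)).
  move=> us; rewrite ltn_sorted_uniq_leq.
  rewrite (perm_uniq (perm_map key (perm_srt _ _))) us.
  by rewrite sorted_map sort_sorted // => b c; apply: leq_total.
have srtK k1 k2 s : Q s -> sorted ltn (map k1 s) -> srt k1 (srt k2 s) = s.
  move=> Qs ss; apply: (perm_sorted_eq (key := k1)) => //; last first.
    by rewrite (perm_trans (perm_srt _ _)).
  apply: sorted_srt; rewrite (perm_uniq (perm_map k1 (perm_srt _ _))).
  by move: ss; rewrite ltn_sorted_uniq_leq => /andP[].
have pS : perm_eq (map (srt key1) S2) S1.
  apply: uniq_perm => // [|s].
    rewrite map_inj_in_uniq // => s t; rewrite !memS2 => /andP[Qs ss].
    by move=> /andP[Qt st] /(congr1 (srt key2)); rewrite !srtK.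
  apply/mapP/idP => [[t]|].
    rewrite memS2 memS1 => /andP[Qt st] ->.
    by rewrite (Qperm t) 1?perm_sym // sorted_srt // Quniq1.
  rewrite memS1 => /andP[Qs ss]; exists (srt key2 s); last by rewrite srtK.
  by rewrite memS2 (Qperm s) 1?perm_sym // sorted_srt // Quniq2.
rewrite -(perm_big _ pS) big_map; apply: eq_bigr => s _.
exact: Fperm (perm_srt _ _).
Qed.

(** The property of being a partition of [x] into nonempty increasing blocks
    which is common to both orders of the blocks, by first entry
    and by size. *)
Definition is_partition (x : seq nat) (bs : seq (seq nat)) : bool :=
  [&& perm_eq (flatten bs) x, all (sorted ltn) bs
    & all (fun b => b != [::]) bs].

Lemma is_partition_perm x bs cs :
  perm_eq bs cs -> is_partition x bs -> is_partition x cs.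
Proof.
move=> pbc; rewrite /is_partition !(perm_all _ pbc) => /andP[pbx ->].
by rewrite -(permPl (perm_flatten pbc)) pbx.
Qed.

Lemma partition_heads_subseq (bs : seq (seq nat)) :
  all (fun b => b != [::]) bs -> subseq (map (head 0%N) bs) (flatten bs).
Proof.
elim: bs => [//|[//|a b] bs IH] /= /IH sub; rewrite eqxx.
exact: subseq_trans sub (suffix_subseq _ _).
Qed.

Lemma perm_ltn_sorted_eq (u v : seq nat) :
  sorted ltn u -> sorted ltn v -> perm_eq u v -> u = v.
Proof.
by move=> su sv; apply: (perm_sorted_eq (key := id)); rewrite map_id.
Qed.

(** Listing the blocks of a set partition by first entries agrees with the
    recursion because the least entry starts the first block; removing that
    block leaves such a list for the other half of a splitting. *)
Lemma mem_set_partitions (x : seq nat) bs : sorted ltn x ->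
  (bs \in set_partitions x) =
  is_partition x bs && sorted ltn (map (head 0%N) bs).
Proof.
have [n] := ubnP (size x); elim: n x bs => // n IH [|a x] bs ltxn sx.
  rewrite /set_partitions /= inE /is_partition; case: bs => [//|[|b u] bs] /=.
    by rewrite !andbF.
  by apply/esym/negP => /andP[/andP[/perm_size]].
have ax : all (ltn a) x by apply: order_path_min sx; apply: ltn_trans.
have {}sx := path_sorted sx.
rewrite set_partitions_cons; apply/allpairsPdep/idP.
  move=> [[u v] [cs [/[dup] /mem_splits_size /= szuv]]].
  rewrite mem_splits // => /and3P[puv su sv]; rewrite IH //; last first.
    by move: ltxn => /=; lia.
  move=> /andP[/and3P[pcs scs ncs] hcs] -> /=.
  have subx c : c \in u ++ v -> (a < c)%N.
    by rewrite (perm_mem puv); apply/allP.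
  rewrite /is_partition /= scs ncs perm_cons.
  rewrite !path_sortedE; try exact: ltn_trans.
  rewrite su hcs !andbT -(permPr puv) perm_cat2l pcs /=; apply/andP; split.
    by apply/allP => c cu; apply: subx; rewrite mem_cat cu.
  apply/allP => c /(mem_subseq (partition_heads_subseq ncs)).
  by rewrite (perm_mem pcs) => cv; apply: subx; rewrite mem_cat cv orbT.
case/andP => /and3P[].
case: bs => [/perm_size//|b cs] pbs /= /andP[sb scs] /andP[nb ncs] hbs.
have hba : head 0%N b = a.
  have ltac c : c \in a :: x -> (a <= c)%N.
    by rewrite inE => /orP[/eqP -> //|/(allP ax) /ltnW].
  (* One inequality: head b is an entry of a :: x.  The other: a lies in some
     block, whose head is at most a and at least head b. *)
  apply/eqP; rewrite eqn_leq ltac ?andbT; last first.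
    rewrite -(perm_mem pbs) /= mem_cat; case: b nb {sb hbs pbs} => //= b u _.
    by rewrite mem_head.
  have : a \in flatten (b :: cs) by rewrite (perm_mem pbs) mem_head.
  have headmin (c : seq nat) : sorted ltn c -> a \in c -> (head 0%N c <= a)%N.
    case: c => //= c u /(order_path_min ltn_trans) cu.
    by rewrite inE => /orP[/eqP -> //|/(allP cu) /ltnW].
  rewrite /= mem_cat => /orP[|/flattenP[c ccs ac]]; first exact: headmin.
  apply: leq_trans (headmin c (allP scs _ ccs) ac).
  have /allP := order_path_min ltn_trans hbs.
  by move=> hmin; apply: ltnW; apply: hmin; apply: map_f.
case: b nb hba sb hbs pbs => //= b u _ -> sau hbs; rewrite perm_cons => pux.
have su := path_sorted sau.
pose v := sort leq (flatten cs).
have pv : perm_eq v (flatten cs) by rewrite perm_sort.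
have sv : sorted ltn v.
  rewrite ltn_sorted_uniq_leq (sort_sorted leq_total) (perm_uniq pv) andbT.
  have : uniq x by move: sx; rewrite ltn_sorted_uniq_leq => /andP[].
  by rewrite -(perm_uniq pux) cat_uniq => /and3P[].
have uvx : (u, v) \in splits x.
  by rewrite mem_splits // su sv andbT -(permPr pux) perm_cat2l pv.
exists (u, v), cs; split=> //=; rewrite IH //; last first.
  by have /= := mem_splits_size uvx; move: ltxn => /=; lia.
by rewrite /is_partition perm_sym pv scs ncs (path_sorted hbs).
Qed.

Lemma uniq_set_partitions (x : seq nat) :
  sorted ltn x -> uniq (set_partitions x).
Proof.
have [n] := ubnP (size x); elim: n x => // n IH [|a x] ltxn sx //.
have {}sx := path_sorted sx.
have sorted_snd uv : uv \in splits x -> sorted ltn uv.2.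
  by case: uv => u v; rewrite mem_splits // => /and3P[].
rewrite set_partitions_cons; apply: allpairs_uniq_dep.
- by apply: uniq_splits; move: sx; rewrite ltn_sorted_uniq_leq => /andP[].
- move=> [u v] /[dup] /sorted_snd /= sv /mem_splits_size /= szuv.
  by apply: IH => //; move: ltxn => /=; lia.
- move=> _ _ /allpairsPdep[[u v] [bs [uvx bsv ->]]]
    /allpairsPdep[[u' v'] [cs [uvx' csv ->]]] /= [eu ebs].
  move: bsv csv => /=.
  rewrite !mem_set_partitions ?(sorted_snd _ uvx) ?(sorted_snd _ uvx') //.
  move=> /andP[/and3P[pv _ _] _] /andP[/and3P[pv' _ _] _].
  have ev : v = v'.
    apply: perm_ltn_sorted_eq (sorted_snd _ uvx) (sorted_snd _ uvx') _.
    by rewrite -(permPl pv) ebs.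
  by rewrite eu ev ebs.
Qed.

(** For blocks of numbers below [n], comparing keys is comparing sizes and then
    first entries, which is the order of the blocks in S'. *)
Definition block_key n (b : seq nat) : nat := (size b * n + head 0 b)%N.

Lemma sorted_block_key n (bs : seq (seq nat)) :
  all (fun b => head 0 b < n)%N bs ->
  sorted ltn (map (block_key n) bs) =
  sorted leq (shape bs) &&
  sorted (fun b c => (size b == size c) ==> (head 0 b < head 0 c)%N) bs.
Proof.
move=> ltbs; rewrite !sorted_map -sorted_relI; apply: eq_in_sorted ltbs => b c.
rewrite -!topredE /= /block_key => ltb ltc.
case: (ltngtP (size b) (size c)) => [?|?|->] /=; [nia|nia|].
by rewrite ltn_add2l.
Qed.

(** The index sets of [sum_S'] as lists: the tuples (i_1,...,i_r), and then the
    blocks cut out by an unshuffle. *)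
Definition S'_shapes n : seq (seq nat) :=
  [seq [seq val j | j <- tval i] | r <- iota 1 n,
                                   i <- enum {: r.-tuple 'I_n.+1}].

Definition S'_blocks n : seq (seq (seq nat)) :=
  [seq reshape sh (oneline t) | sh <- S'_shapes n,
                                t <- enum [pred t : 'S_n | unshuffle' sh t]].

Lemma mem_S'_shapes n (sh : seq nat) :
  all (leq 1) sh -> sumn sh = n -> (0 < n)%N -> sh \in S'_shapes n.
Proof.
move=> sh1 sumsh n0; apply/allpairsPdep.
have lesize : (size sh <= n)%N.
  by rewrite -sumsh; elim: sh sh1 {sumsh} => //= a sh IH /andP[a1 /IH]; lia.
have leall : all (fun i => i < n.+1)%N sh.
  rewrite -sumsh; elim: sh {sh1 sumsh lesize} => //= a sh IH.
  by rewrite ltnS leq_addr; apply: sub_all IH => i; lia.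
exists (size sh), (map_tuple inord (in_tuple sh)); split.
- rewrite mem_iota add1n ltnS lesize andbT lt0n size_eq0.
  by apply: contraTneq n0 => e; rewrite -sumsh e.
- by rewrite mem_enum.
rewrite /= -map_comp map_id_in // => i /(allP leall) lti /=.
by rewrite inordK.
Qed.

Lemma uniq_S'_blocks n : uniq (S'_blocks n).
Proof.
apply: allpairs_uniq_dep => [|sh _|].
- apply: allpairs_uniq_dep => [|r _|]; [exact: iota_uniq|exact: enum_uniq|].
  move=> [r i] [r' i'] _ _ /= eii.
  have er : r = r' by have := congr1 size eii; rewrite !size_map !size_tuple.
  subst r'; congr Tagged; apply/val_inj; apply: inj_map eii; exact: val_inj.
- exact: enum_uniq.
move=> _ _ /allpairsPdep[sh [t [_ tsh ->]]] /allpairsPdep[sh' [t' [_ tsh' ->]]].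
move: tsh tsh'; rewrite !mem_enum !inE /=.
move=> /and4P[_ _ /andP[/eqP sumsh _] _] /and4P[_ _ /andP[/eqP sumsh' _] _] e.
have esh : sh = sh'.
  by have := congr1 shape e; rewrite !reshapeKl ?size_oneline ?sumsh ?sumsh'.
subst sh'; congr Tagged; apply: oneline_inj.
by have := congr1 flatten e; rewrite !reshapeKr ?size_oneline ?sumsh.
Qed.

Lemma oneline_of_perm n (w : seq nat) :
  perm_eq w (iota 0 n) -> exists t : 'S_n, oneline t = w.
Proof.
rewrite -mem_permutations -(perm_mem (perm_oneline n)) => /mapP[t _ ->].
by exists t.
Qed.

Lemma perm_eq_oneline n (t : 'S_n) : perm_eq (oneline t) (iota 0 n).
Proof.
by rewrite -mem_permutations -(perm_mem (perm_oneline n)) map_f ?mem_enum.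
Qed.

Lemma partition_heads_lt n bs :
  is_partition (iota 0 n) bs -> all (fun b => head 0 b < n)%N bs.
Proof.
move=> /and3P[pbs _ nbs]; apply/allP => b bbs.
have := mem_subseq (partition_heads_subseq nbs) (map_f (head 0%N) bbs).
by rewrite (perm_mem pbs) mem_iota.
Qed.

Lemma mem_S'_blocks n bs : (0 < n)%N ->
  (bs \in S'_blocks n) =
  is_partition (iota 0 n) bs && sorted ltn (map (block_key n) bs).
Proof.
move=> n0; apply/allpairsPdep/idP => [[sh [t [_]]]|/andP[bsP sbs]].
  rewrite mem_enum inE => /and4P[sh1 ssh /andP[/eqP sumsh st] hst] ->.
  have szt : size (oneline t) = sumn sh by rewrite size_oneline sumsh.
  have bsP : is_partition (iota 0 n) (reshape sh (oneline t)).
    rewrite /is_partition reshapeKr ?szt // perm_eq_oneline st /=.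
    move: sh1; rewrite -{1}(@reshapeKl _ sh (oneline t)) ?szt // all_map.
    by apply: sub_all => -[].
  rewrite bsP sorted_block_key ?partition_heads_lt // reshapeKl ?szt //.
  by rewrite ssh hst.
have /and3P[pbs obs nbs] := bsP; have [t et] := oneline_of_perm pbs.
have sumsh : sumn (shape bs) = n.
  by rewrite -size_flatten (perm_size pbs) size_iota.
have sh1 : all (leq 1) (shape bs).
  by rewrite all_map; apply: sub_all nbs => -[].
exists (shape bs), t; rewrite et flattenK mem_S'_shapes // mem_enum inE.
move: sbs; rewrite sorted_block_key ?partition_heads_lt // => /andP[ssh hsh].
by rewrite /unshuffle' /unshuffle et flattenK sh1 ssh sumsh eqxx obs hsh.
Qed.

(** On the empty sequence the two sides differ: the sum over r is empty, while
    there is one partition, with no blocks. *)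
Lemma sum_S'E (U : nmodType) (V : nmodType) (x : seq U) (F : seq (seq U) -> V) :
  (0 < size x)%N -> (forall bs cs, perm_eq bs cs -> F bs = F cs) ->
  sum_S' x F = psum x F.
Proof.
move=> x0 Fperm; set n := size x.
rewrite -[in RHS](map_nth_iota_id x) psum_map -/n.
pose G bs := F (map (map (nth 0 x)) bs).
have Gperm bs cs : perm_eq bs cs -> G bs = G cs.
  by move=> pbc; apply: Fperm; apply: perm_map.
transitivity (\sum_(bs <- S'_blocks n) G bs).
  rewrite big_allpairs_dep big_allpairs_dep /sum_S' /index_iota subn1 /=.
  apply: eq_bigr => r _; rewrite big_enum /=; apply: eq_bigr => i _.
  rewrite big_enum /=; apply: eq_bigr => t _.
  by rewrite /G map_reshape.
have uheads bs : is_partition (iota 0 n) bs -> uniq (map (head 0%N) bs).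
  move=> /and3P[pbs _ /partition_heads_subseq/subseq_uniq]; apply.
  by rewrite (perm_uniq pbs) iota_uniq.
apply: (big_resort (Q := is_partition (iota 0 n)) (key1 := block_key n)
  (key2 := head 0%N)) Gperm => //.
- by move=> bs cs; apply: is_partition_perm.
(* The head of a block is the remainder of its key modulo n. *)
- move=> bs bsP; apply: (@map_uniq _ _ (modn^~ n)).
  rewrite -map_comp (_ : map _ _ = map (head 0%N) bs) ?uheads //.
  apply/eq_in_map => b bbs /=; rewrite /block_key modnMDl modn_small //.
  exact: (allP (partition_heads_lt bsP)).
- exact: uniq_S'_blocks.
- by move=> bs; apply: mem_S'_blocks.
- exact/uniq_set_partitions/iota_ltn_sorted.
- by move=> bs; apply/mem_set_partitions/iota_ltn_sorted.
Qed.

(** * Multilinearity, degree and symmetry of sums over set partitions *)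

Lemma psum_multilinear (U W V : lmodType 'F_2) (I : seq U -> W)
    (g : seq W -> V) :
  multilinear I -> multilinear g ->
  multilinear (fun x => psum x (fun bs => g (map I bs))).
Proof.
move=> Iml gml s1 s2 a u v.
(* With the recursion bound fixed, multilinearity makes sense for sequences of
   all lengths, as needed for the two factors in ssum_multilinear. *)
suff recml n : multilinear (fun x =>
    \sum_(bs <- set_partitions_rec n x) g (map I bs)).
  have := recml (size (s1 ++ u :: s2)) s1 s2 a u v.
  by rewrite !set_partitions_rec_fuel // !size_cat.
elim: n g gml {s1 s2 a u v} => [|n IH] g gml [|c s1] s2 a u v /=;
  rewrite ?big_nil ?scaler0 ?addr0 //.
  rewrite !big_allpairs_dep.
  rewrite -!(ssum_splits _ (fun y z => \sum_(bs <- set_partitions_rec n z)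
    g (map I ((_ :: y) :: bs)))).
  rewrite -ssum_lin; apply: eq_ssum => y z.
  rewrite scaler_sumr -big_split; apply: eq_bigr => bs _ /=.
  by rewrite (Iml [::]) (gml [::]).
rewrite !big_allpairs_dep.
rewrite -!(ssum_splits _ (fun y z => \sum_(bs <- set_partitions_rec n z)
    g (map I ((c :: y) :: bs)))).
apply: (ssum_multilinear (F := fun y z => \sum_(bs <- set_partitions_rec n z)
    g (map I ((c :: y) :: bs)))) => [z t1 t2 b p q|y].
  rewrite scaler_sumr -big_split; apply: eq_bigr => bs _ /=.
  by rewrite (Iml (c :: t1)) (gml [::]).
apply: (IH (fun w => g (I (c :: y) :: w))) => t1 t2.
exact: (gml (I (c :: y) :: t1)).
Qed.

(** A block of size i contributes i - 1 to the degree, so the degree of a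
    summand with r blocks exceeds that of g by (size x) - r.  The hypothesis on
    [g] has the term [size y] to absorb r, and it is inherited by the map
    g (I (a :: u) :: _) of the recurrence. *)
Lemma psum_homog (U W V : gvect) (I : seq U -> W) (g : seq W -> V) (c : int)
    ds (x : seq U) :
  has_degree (fun n => n%:Z - 1) I ->
  (forall ds y, homogeneous ds y ->
     homog (\sum_(d <- ds) d + (size y)%:Z + c) (g y)) ->
  homogeneous ds x ->
  homog (\sum_(d <- ds) d + (size x)%:Z + c) (psum x (fun bs => g (map I bs))).
Proof.
move=> Ideg; have [n] := ubnP (size x).
elim: n x ds g c => // n IH [|a x] [|d ds] g c ltxn gdeg hx; try by case: hx.
  by rewrite psum_nil; apply: (gdeg [::] [::]).
have [ha hx'] := (homogeneous_cons _ _ _ _).1 hx.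
rewrite psum_cons; apply: homog_ssum hx' _ => ds1 ds2 u v hu hv sumds szuv.
have hI : homog (\sum_(e <- d :: ds1) e + ((size (a :: u))%:Z - 1))
                (I (a :: u)).
  by apply: Ideg => //; apply/homogeneous_cons.
have {}gdeg ds' y : homogeneous ds' y ->
    homog (\sum_(e <- ds') e + (size y)%:Z
           + (\sum_(e <- d :: ds1) e + (size (a :: u))%:Z + c))
          (g (I (a :: u) :: y)).
  move=> hy.
  have := gdeg (_ :: _) _ ((homogeneous_cons _ _ _ _).2 (conj hI hy)).
  by congr homog; rewrite big_cons /= !intS; ring.
have ltvn : (size v < n)%N by move: ltxn => /=; lia.
have := IH v ds2 (fun w => g (I (a :: u) :: w)) _ ltvn gdeg hv.
by congr homog; rewrite !big_cons -sumds /= -szuv !intS PoszD; ring.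
Qed.

Lemma perm_swap_head (T : eqType) (a b : T) s :
  perm_eq [:: a, b & s] [:: b, a & s].
Proof. exact: permEl (perm_catCA [:: a] [:: b] s). Qed.

(** It suffices to swap the first two entries [a] and [b].  Either they share
    a block, and the symmetry of [F] in the block applies, or they start two
    distinct blocks, and the symmetry of [F] in the blocks applies. *)
Lemma psum_perm (T : eqType) (V : nmodType) (x y : seq T)
    (F : seq (seq T) -> V) :
  (forall bs cs, perm_eq bs cs -> F bs = F cs) ->
  (forall b c bs, perm_eq b c -> F (b :: bs) = F (c :: bs)) ->
  perm_eq x y -> psum x F = psum y F.
Proof.
have [n] := ubnP (size x); elim: n x y F => // n IH.
have IHcons (a : T) x y (F : seq (seq T) -> V) : (size x < n)%N ->
    (forall bs cs, perm_eq bs cs -> F bs = F cs) ->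
    (forall b c bs, perm_eq b c -> F (b :: bs) = F (c :: bs)) ->
    perm_eq x y -> psum (a :: x) F = psum (a :: y) F.
  move=> ltxn Fperm Fblock pxy; rewrite !psum_cons.
  (* ssum_perm asks for an invariant summand on all sequences, while the
     induction hypothesis covers short ones only: cut off at length n. *)
  pose H u v :=
    if (size v < n)%N then psum v (fun bs => F ((a :: u) :: bs)) else 0.
  have HE z : (size z < n)%N ->
      ssum z (fun u v => psum v (fun bs => F ((a :: u) :: bs))) = ssum z H.
    move=> ltzn; apply: eq_ssum_size => u v szuv; rewrite /H ifT //; lia.
  rewrite !HE -?(perm_size pxy) //; apply: ssum_perm pxy => u u' v v' pu pv.
  rewrite /H -(perm_size pv); case: ifP => // ltvn.
  rewrite (IH v v') // => [|bs cs pbs|b c bs pbc].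
  - by apply: eq_psum => bs; apply: Fblock; rewrite perm_cons.
  - by apply: Fperm; rewrite perm_cons.
  rewrite (Fperm _ _ (perm_swap_head _ b _)) (Fblock b c) //.
  exact/Fperm/perm_swap_head.
case=> [|a x] [|b y] F ltxn Fperm Fblock; try by move=> /perm_size.
move=> pxy; have [eab|neab] := eqVneq a b.
  by subst b; apply: IHcons => //; rewrite -(perm_cons a).
have ay : a \in y.
  have : a \in b :: y by rewrite -(perm_mem pxy) mem_head.
  by rewrite inE (negPf neab).
pose z := rem a y; have py : perm_eq y (a :: z) by apply: perm_to_rem.
have px : perm_eq x (b :: z).
  rewrite -(perm_cons a) (perm_trans pxy) //.
  by rewrite (permPr (perm_swap_head a b z)) perm_cons.
rewrite (IHcons a _ (b :: z)) //.
have szy : size y = size x by have [] := perm_size pxy.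
rewrite [RHS](IHcons b _ (a :: z)) ?szy //.
rewrite !psum_cons /=; congr (_ + _).
  apply: eq_ssum => u v; apply: eq_psum => bs.
  exact/Fblock/perm_swap_head.
under eq_ssum => u v do rewrite psum_cons.
under [RHS]eq_ssum => u v do rewrite psum_cons.
rewrite -/(ssum3 z (fun u v w =>
  psum w (fun bs => F [:: a :: u, b :: v & bs]))).
rewrite ssum3_swap12; apply: eq_ssum3 => u v w; apply: eq_psum => bs.
exact/Fperm/perm_swap_head.
Qed.

(** * Restriction of scalars *)

Lemma multilinear_headD (U V : lmodType 'F_2) (f : seq U -> V) x :
  multilinear f -> {morph (fun u => f (u :: x)) : u v / u + v}.
Proof. by move=> fml u v; have := fml [::] x 1 u v; rewrite !scale1r. Qed.

Lemma multilinear_head0 (U V : lmodType 'F_2) (f : seq U -> V) x :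
  multilinear f -> f (0 :: x) = 0.
Proof.
move=> /(multilinear_headD x)/(_ 0 0)/eqP.
by rewrite addr0 -subr_eq0 opprD addNKr oppr_eq0 => /eqP.
Qed.

Section Restriction.
Variables (L' L : linfty_alg) (I : linfty_hom L' L).

Lemma restrE (M N : gvect) (g : seq L -> M -> N) x m :
  (forall m, symmetric_maps (g^~ m)) ->
  restr I g x m = psum x (fun bs => g (map I bs) m).
Proof.
move=> gsym; case: x => [|a x]; first by rewrite psum_nil.
apply: sum_S'E => // bs cs pbs.
exact: (symmetric_permP (g^~ m)).1 (gsym m) _ _ (perm_map I pbs).
Qed.

(** This is the relation in the definition of the homomorphism [I], in the form
    in which it can be substituted into sums over splittings. *)
Lemma psum_la_op (x : seq L') :
  (0 < size x)%N ->
  psum x (fun bs => la_op (map I bs)) =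
  ssum x (fun u v => if u is [::] then 0 else I (la_op u :: v)).
Proof.
move=> x0; have [_ _ _ rel] := lh_ax I.
have [_ lsym _ _] := la_ax L.
rewrite -sum_S'E //; last first.
  by move=> bs cs pbs; apply: (symmetric_permP _).1 lsym _ _ (perm_map I pbs).
rewrite -rel // -[in RHS](map_nth_iota_id x) ssum_map.
rewrite -(sum_unshuffle (size x)) [RHS]big_nat_recl //.
rewrite [X in _ = X + _]big1 ?add0r.
  rewrite big_add1; apply: eq_big_nat => p /andP[_ ltpx].
  apply: eq_bigr => s _; rewrite take_permute drop_permute.
  have : size (take p.+1 (oneline s)) = p.+1.
    by rewrite size_takel // size_oneline.
  by case: (take _ _).
by move=> s _; rewrite take0.
Qed.

(** As [g] is additive in its module argument, the left-hand side is a sum over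
    splittings of [x] and partitions of both halves, and psum_ssum applies. *)
Lemma ssum_restr (M N P : gvect) (k : seq L -> M -> N) (g : seq L -> N -> P)
    (x : seq L') (m : M) :
  multilinear_mod g -> (forall m, symmetric_maps (g^~ m)) ->
  (forall m, symmetric_maps (k^~ m)) ->
  ssum x (fun u v => restr I g v (restr I k u m)) =
  psum x (fun bs => ssum (map I bs) (fun u v => g v (k u m))).
Proof.
move=> gml gsym ksym.
under [RHS]eq_psum => bs do rewrite ssum_map.
rewrite (psum_ssum x (fun bs cs => g (map I cs) (k (map I bs) m))).
apply: eq_ssum => u v; rewrite !restrE // [RHS]exchange_big.
apply: eq_psum => cs.
by apply: psum_additive; [apply: modmap0 | apply: modmapD].
Qed.

(** The second sum in [mod_lhs] is an instance of ssum_restr.  In the first sum,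
    an input l'(u) of the restricted map lies in the first block of the
    partition, whose other entries v are arbitrary.  With w the remaining inputs,
    the terms with u and v together fixed form one side of the relation for
    [I], whose other side applies l to a partition of u and v. *)
Lemma mod_lhs_restr (M N : gvect) (k : seq L -> M -> M) (g : seq L -> M -> N)
    (x : seq L') (m : M) :
  multilinear_mod g -> (forall m, symmetric_maps (g^~ m)) ->
  (forall m, symmetric_maps (k^~ m)) ->
  mod_lhs (restr I k) (restr I g) x m =
  psum x (fun bs => mod_lhs k g (map I bs) m).
Proof.
move=> gml gsym ksym; rewrite mod_lhsE ssum_restr //.
under [RHS]eq_psum => bs do rewrite mod_lhsE.
rewrite psumD; congr (_ + _).
pose H u v w := if u is [::] then 0
  else psum w (fun bs => g (I (la_op u :: v) :: map I bs) m).
transitivity (ssum3 x H).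
  apply: eq_ssum => -[|a u] v; first by rewrite ssum0.
  by rewrite restrE // psum_cons.
under [RHS]eq_psum => bs do rewrite ssum_map.
rewrite (psum_ssum x (fun bs cs => if map I bs is [::] then 0
  else g (la_op (map I bs) :: map I cs) m)) -ssumA.
apply: eq_ssum => -[|a u] w.
  by rewrite psum_nil psum0.
have gD cs := multilinear_headD (map I cs) (gml.1 m).
have g0 cs := multilinear_head0 (map I cs) (gml.1 m).
(* The part of the relation for g in which l acts on the blocks of a :: u is
   evaluated by the relation for I. *)
transitivity (psum w (fun cs =>
    g (psum (a :: u) (fun bs => la_op (map I bs)) :: map I cs) m)).
  rewrite psum_la_op //.
  under [RHS]eq_psum => cs do rewrite (ssum_additive _ _ (gD cs)).
  rewrite psum_ssumC; apply: eq_ssum => -[|b u'] v' //.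
  by rewrite -[LHS](psum0 _ w); apply: eq_psum => cs; rewrite g0.
rewrite -(@eq_psum_cons _ _ a u (fun bs => psum w (fun cs =>
  g (la_op (map I bs) :: map I cs) m))) // [RHS]exchange_big.
by apply: eq_psum => cs; apply: (psum_additive _ _ _ (gD cs)).
Qed.

Lemma restr_multilinear (M N : gvect) (g : seq L -> M -> N) :
  multilinear_mod g -> (forall m, symmetric_maps (g^~ m)) ->
  multilinear_mod (restr I g).
Proof.
move=> gml gsym; have [Iml _ _ _] := lh_ax I; split=> [m|x a u v].
  rewrite (_ : _^~ m = fun x => psum x (fun bs => g (map I bs) m)).
    exact: psum_multilinear (gml.1 m).
  by apply: funext => x; rewrite restrE.
rewrite !restrE // /psum scaler_sumr -big_split; apply: eq_bigr => bs _.
exact: gml.2.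
Qed.

Lemma restr_symmetric (M N : gvect) (g : seq L -> M -> N) m :
  (forall m, symmetric_maps (g^~ m)) -> symmetric_maps ((restr I g)^~ m).
Proof.
move=> gsym; have [_ /symmetric_permP Isym _ _] := lh_ax I.
apply/symmetric_permP => x y pxy; rewrite !restrE //.
apply: psum_perm pxy => [bs cs pbs|b c bs pbc].
  exact: (symmetric_permP (g^~ m)).1 (gsym m) _ _ (perm_map I pbs).
by rewrite /= (Isym _ _ pbc).
Qed.

Lemma restr_degree (M N : gvect) (g : seq L -> M -> N) (c : int) :
  (forall m, symmetric_maps (g^~ m)) ->
  has_degree_mod (fun n => n%:Z + c) g ->
  has_degree_mod (fun n => n%:Z + c) (restr I g).
Proof.
move=> gsym gdeg ds e x m hx hm; have [_ _ Ideg _] := lh_ax I.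
rewrite restrE //.
have := @psum_homog _ _ _ I (g^~ m) (e + 1 + c) ds x Ideg _ hx.
have shift (d : int) n : d + n%:Z + (e + 1 + c) = d + e + (n.+1%:Z + c).
  by rewrite intS; ring.
rewrite shift; apply => ds' y hy; rewrite shift.
exact: gdeg.
Qed.

Lemma restr_is_mod (M : linfty_mod L) : is_linfty_mod (restr I (@lm_op L M)).
Proof.
have [kml ksym kdeg krel] := lm_ax M; split.
- exact: restr_multilinear.
- by move=> m; apply: restr_symmetric.
- exact: restr_degree.
move=> x m; rewrite mod_lhs_restr // -[RHS](psum0 _ x).
by apply: eq_psum => bs; apply: krel.
Qed.

Definition restr_mod (M : linfty_mod L) : linfty_mod L' :=
  LInftyMod (restr_is_mod M).

Lemma restr_is_mod_hom (M N : linfty_mod L) (f : linfty_mod_hom M N) :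
  @is_linfty_mod_hom L' (restr_mod M) (restr_mod N) (restr I f).
Proof.
have [kml ksym _ _] := lm_ax M; have [kml' ksym' _ _] := lm_ax N.
have [fml fsym fdeg frel] := mh_ax f; split.
- exact: restr_multilinear.
- by move=> m; apply: restr_symmetric.
- exact: restr_degree.
move=> x m; cbv zeta; rewrite mod_rhsE mod_lhs_restr // ssumC ssum_restr //.
apply: eq_psum => bs; have := frel (map I bs) m; cbv zeta.
by rewrite mod_rhsE [in RHS]ssumC.
Qed.

Lemma restr_mod_id (M : linfty_mod L) x (m : M) :
  restr I (@mod_id L M) x m = mod_id (M := restr_mod M) x m.
Proof.
rewrite restrE; last by case: (mh_ax (mod_hom_id M)).
case: x => [|a x]; first by rewrite psum_nil.
by rewrite psum_cons -[RHS](ssum0 _ x); apply: eq_ssum => u v; apply: psum0.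
Qed.

Lemma restr_mod_comp (A B C : linfty_mod L) (g : linfty_mod_hom B C)
    (f : linfty_mod_hom A B) x (m : A) :
  restr I (mod_comp g f) x m =
  mod_comp (A := restr_mod A) (B := restr_mod B) (C := restr_mod C)
    (restr I g) (restr I f) x m.
Proof.
have [_ fsym _ _] := mh_ax f; have [gml gsym _ _] := mh_ax g.
rewrite mod_compE ssum_restr // restrE; last by case: (mod_comp_hom g f).
by apply: eq_psum => bs; rewrite mod_compE.
Qed.

End Restriction.

Theorem theorem1 (L L' : linfty_alg) (I : linfty_hom L' L) :
  exists (wd_ob : forall M : linfty_mod L,
            @is_linfty_mod L' M (restr I (@lm_op L M)))
         (wd_hom : forall (M N : linfty_mod L) (f : linfty_mod_hom M N),
            @is_linfty_mod_hom L' (LInftyMod (wd_ob M)) (LInftyMod (wd_ob N))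
              (restr I f)),
    @is_functor (Lmod L) (Lmod L')
      (fun M => LInftyMod (wd_ob M))
      (fun M N f => LInftyModHom (wd_hom M N f)).
Proof.
exists (restr_is_mod I), (@restr_is_mod_hom _ _ I).
split=> [M|A B C g f]; apply: mod_hom_ext => x m.
  exact: (restr_mod_id I x m).
exact: (restr_mod_comp I g f x m).
Qed.
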